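(* Let $r\le0$, let $j_0\in D(\mathbb{R}^3;\mathbb{R})$ be spherically symmetric with $q:=\int j_0(\mathbf x)\,d^3\mathbf x\neq0$, and let $\mathbf v^{\mathrm{in}},\mathbf v^{\mathrm{out}}\in\mathbb{R}^3$ with $|\mathbf v^{\mathrm{in}}|,|\mathbf v^{\mathrm{out}}|<1$ and $\mathbf v^{\mathrm{in}}\neq\mathbf v^{\mathrm{out}}$. For $\mathbf v\in\{\mathbf v^{\mathrm{in}},\mathbf v^{\mathrm{out}}\}$ let $g^{\mathbf v}(\mathbf k)=i\tilde j_0(\mathbf k)|\mathbf k|^{-3/2}(1-\hat{\mathbf k}\cdot\mathbf v)^{-1}$ and $g^{\mathbf v}_\sigma(\mathbf k)=\chi_{[\sigma,\infty)}(|\mathbf k|)g^{\mathbf v}(\mathbf k)$. Then $\lim_{\sigma\to0}\|T_r(g^{\mathbf v^{\mathrm{out}}}_\sigma-g^{\mathbf v^{\mathrm{in}}}_\sigma)\|_2=\infty$.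
   Context: $\hat{\mathbf k}=\mathbf k/|\mathbf k|$, $\tilde j_0(\mathbf k)=(2\pi)^{-3/2}\int e^{-i\mathbf k\cdot\mathbf x}j_0(\mathbf x)d^3\mathbf x$. Let $\varepsilon_i=2^{-(i-1)}$, $b_i=1/i$ ($i\ge1$), $\tau_i=\varepsilon_i^{\,r-1}$, $\mu(\mathbf k)=|\mathbf k|$, $u_s$ = multiplication by $e^{i\mu s}$ on $L^2(\mathbb{R}^3)$, $\zeta^\circ_i(|\mathbf k|)=(\log2)^{-1/2}\chi_{[\varepsilon_{i+1},\varepsilon_i]}(|\mathbf k|)|\mathbf k|^{-3/2}$, and $Q_i$ the orthogonal projection onto span$\{\zeta^\circ_i(|\mathbf k|)Y_{\ell m}(\hat{\mathbf k}):0\le\ell\le i,|m|\le\ell\}$, $Y_{\ell m}$ real spherical harmonics. $T_r=1+\sum_i(b_i^{-1}-1)u_{-\tau_i}Q_i\,\mathrm{Re}\,u_{\tau_i}+i\sum_i(b_i-1)u_{-\tau_i}Q_i\,\mathrm{Im}\,u_{\tau_i}$ (real-linear; Re, Im pointwise; only finitely many terms act nontrivially on the cut-off functions). *)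

(* Defs.v *)
From HB Require Import structures.
From mathcomp Require Import all_boot all_order all_algebra.
From mathcomp Require Import all_classical all_reals all_analysis.
Set Implicit Arguments. Unset Strict Implicit. Unset Printing Implicit Defensive.
Import Order.TTheory GRing.Theory Num.Theory.
Import numFieldNormedType.Exports.
Local Open Scope classical_set_scope.
Local Open Scope ring_scope.

Section Defs.
Variable R : realType.

Definition V3 := (R * R * R)%type.
Definition mkV (a b c : R) : V3 := (a, b, c).
Definition c1 (x : V3) : R := x.1.1.
Definition c2 (x : V3) : R := x.1.2.
Definition c3 (x : V3) : R := x.2.

Definition dot (x y : V3) : R := c1 x * c1 y + c2 x * c2 y + c3 x * c3 y.
Definition enorm (x : V3) : R := Num.sqrt (dot x x).
Definition khat (k : V3) : V3 :=
  mkV (c1 k / enorm k) (c2 k / enorm k) (c3 k / enorm k).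

Definition leb3 := ((@lebesgue_measure R \x @lebesgue_measure R)
                      \x @lebesgue_measure R)%E.

Fixpoint iterD (vs : seq V3) (f : V3 -> R) : V3 -> R :=
  match vs with
  | [::] => f
  | v :: vs' => 'D_v (iterD vs' f)
  end.
Definition smooth (f : V3 -> R) : Prop :=
  forall vs : seq V3, continuous (iterD vs f) /\
    forall x v : V3, derivable (iterD vs f) x v.

Definition test_function (f : V3 -> R) : Prop :=
  smooth f /\ exists M : R, forall x, M < enorm x -> f x = 0.

Definition spherically_symmetric (f : V3 -> R) : Prop :=
  forall x y, enorm x = enorm y -> f x = f y.

(* Complex-valued functions on R^3 are represented as pairs (Re, Im). *)
Definition cfun := V3 -> (R * R)%type.

(* Fourier transform \tilde j_0(k) = (2pi)^{-3/2} \int e^{-ik.x} j_0(x) d^3x *)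
Definition FT (j : V3 -> R) (k : V3) : R * R :=
  (powR (2 * pi) (- (3 / 2)) * Rintegral leb3 setT (fun x => cos (dot k x) * j x),
   - (powR (2 * pi) (- (3 / 2)) * Rintegral leb3 setT (fun x => sin (dot k x) * j x))).

Definition gfun (j : V3 -> R) (v : V3) : cfun := fun k =>
  let w := powR (enorm k) (- (3 / 2)) / (1 - dot (khat k) v) in
  (- (FT j k).2 * w, (FT j k).1 * w).

Definition gcut (j : V3 -> R) (v : V3) (sigma : R) : cfun := fun k =>
  if sigma <= enorm k then gfun j v k else (0, 0).

Definition csub (F G : cfun) : cfun := fun k => ((F k).1 - (G k).1, (F k).2 - (G k).2).

Definition L2norm (F : cfun) : \bar R :=
  Lnorm leb3 2%:E (fun k => (Num.sqrt ((F k).1 ^+ 2 + (F k).2 ^+ 2))%:E).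

(* parameters, indexed by i >= 1 *)
Definition eps (i : nat) : R := (2^-1) ^+ i.-1.
Definition bb (i : nat) : R := (i%:R)^-1.
Definition tau (r : R) (i : nat) : R := powR (eps i) (r - 1).

Definition zeta0 (i : nat) (t : R) : R :=
  if (eps i.+1 <= t) && (t <= eps i) then powR (ln 2) (- (1 / 2)) * powR t (- (3 / 2))
  else 0.

(* Legendre polynomial P_l (Rodrigues formula, up to the nonzero constant 1/(2^l l!)) *)
Definition legendreP (l : nat) : {poly R} := (('X ^+ 2 - 1) ^+ l)^`(l).

Fixpoint cpow (x y : R) (n : nat) : R * R :=
  match n with
  | 0 => (1, 0)
  | n'.+1 => let p := cpow x y n' in (p.1 * x - p.2 * y, p.1 * y + p.2 * x)
  end.

(* Real spherical harmonics of degree l, up to nonzero normalization constants,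
   evaluated at a unit vector u = (x,y,z).  Index j ranges over 0..2l:
   j = 0 -> m = 0; j = 2m-1 -> cos(m phi) type (m>0); j = 2m -> sin(m phi) type (m<0).
   Y ~ P_l^{|m|}(z) * Re/Im (x + i y)^{|m|}, and P_l^{|m|}(cos th) sin^{|m|} th ... *)
Definition Yreal (l j : nat) (u : V3) : R :=
  let m := uphalf j in
  let p := cpow (c1 u) (c2 u) m in
  (legendreP l)^`(m).[c3 u] * (if odd j || (j == 0)%N then p.1 else p.2).

Definition Qfamily (i : nat) : seq (V3 -> R) :=
  flatten [seq [seq (fun k => zeta0 i (enorm k) * Yreal l j (khat k)) | j <- iota 0 (2 * l).+1]
          | l <- iota 0 i.+1].

Definition lincomb (fs : seq (V3 -> R)) (c : seq R) : V3 -> R :=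
  fun k => \sum_(n < size fs) nth 0 c n * nth (fun _ => 0) fs n k.

Definition Qproj (i : nat) (h : V3 -> R) : V3 -> R :=
  let fs := Qfamily i in
  lincomb fs (xget (nseq (size fs) 0)
    [set c : seq R | size c = size fs /\
       forall n, (n < size fs)%N ->
         Rintegral leb3 setT
           (fun k => (h k - lincomb fs c k) * nth (fun _ => 0) fs n k) = 0]).

Definition Tterm (r : R) (F : cfun) (i : nat) (k : V3) : R * R :=
  let t := tau r i in
  let ReU := fun k' => (F k').1 * cos (enorm k' * t) - (F k').2 * sin (enorm k' * t) in
  let ImU := fun k' => (F k').1 * sin (enorm k' * t) + (F k').2 * cos (enorm k' * t) in
  let A := Qproj i ReU k in
  let B := Qproj i ImU k in
  let c := cos (enorm k * t) in
  let s := sin (enorm k * t) in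
  (* (b^-1 - 1) u_{-t} A  +  i (b - 1) u_{-t} B *)
  (((bb i)^-1 - 1) * (A * c) + (bb i - 1) * (B * s),
   ((bb i)^-1 - 1) * (- (A * s)) + (bb i - 1) * (B * c)).

Definition Top (r : R) (F : cfun) : cfun := fun k =>
  ((F k).1 + limn (fun N => \sum_(1 <= i < N) (Tterm r F i k).1),
   (F k).2 + limn (fun N => \sum_(1 <= i < N) (Tterm r F i k).2)).

End Defs.

(* Main.v *)
(**
  On the shell [eps (i+1) < |k| < eps i] only the [i]-th term of [T_r] acts, and
  whatever [Q_i] returns is radially proportional to [|k|^(-3/2)].  Hence
  [|k|^(3/2) e^(i |k| tau_i) (T_r F)(k)] is
  [i FT(k) W(k/|k|) e^(i |k| tau_i)] plus a function of the direction alone, where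
  [W(u) = 1/(1 - u.vout) - 1/(1 - u.vin)].  Comparing the points [k] and [lam k] of
  one ray, with [lam] chosen so that the two phases differ by [|k| / (2 eps i)],
  the directional part cancels and the difference stays bounded below near [k = 0]
  by a multiple of [|q W|].  As [|k|^(-3) d^3k] is dilation invariant, each shell
  with [sigma <= eps (i+1)] contributes at least a fixed amount to the squared norm,
  and the number of such shells grows without bound as [sigma] tends to [0].
*)
Require Import Defs.
From HB Require Import structures.
From mathcomp Require Import all_boot all_order all_algebra.
From mathcomp Require Import all_classical all_reals all_analysis.
From mathcomp Require Import measurable_realfun.
From mathcomp Require Import ring lra.
Set Implicit Arguments. Unset Strict Implicit. Unset Printing Implicit Defensive.
Import Order.TTheory GRing.Theory Num.Theory.
Import numFieldNormedType.Exports.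
Local Open Scope classical_set_scope.
Local Open Scope ring_scope.

(* [leb3] lives on the copy [measurableTypeR R] of [R], whose measurable structure
   has another display than the canonical one of [R]. *)
Notation M3 R := ((measurableTypeR R * measurableTypeR R) * measurableTypeR R)%type.

(** * Borel measurability on $\mathbb{R}^3$ *)

(** Second countability: an open set is a countable union of sup-norm balls with rational centre and
    radius [1 / (n + 1)], and each such ball is a box of intervals. *)
Lemma open_measurable_R3 (R : realType) (U : set (R * R * R)) :
  open U -> measurable (U : set (M3 R)).
Proof.
move=> oU.
pose e (n : nat) : R := n.+1%:R^-1.
pose c (q : rat * rat * rat * nat) : R * R * R :=
  (ratr q.1.1.1, ratr q.1.1.2, ratr q.1.2).
have -> : U = \bigcup_(q : rat * rat * rat * nat)
    (if `[< ball (c q) (e q.2) `<=` U >] then ball (c q) (e q.2) else set0).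
  apply/seteqP; split => [x Ux|x [q _]]; last first.
    by case: ifPn => [/asboolP/[apply]//|].
  have /nbhs_ballP[d /= d0 xdU] : nbhs x U by exact: open_nbhs_nbhs.
  (* One half of [d] covers the distance from [x] to the rational centre, the other half the radius
     of the ball around that centre. *)
  have d20 : 0 < d / 2 by rewrite divr_gt0.
  have [n nd] : exists n, e n < d / 2.
    have [n _ /(_ n (leqnn n)) h] := near_infty_natSinv_lt (PosNum d20).
    by exists n.
  have en0 : 0 < e n by rewrite invr_gt0.
  have near_rat (t : R) : exists q : rat, ball (ratr q : R) (e n) t.
    have te : t - e n < t + e n by rewrite ltrD2l gtrN.
    have [q] := rat_in_itvoo te; rewrite in_itv/= => /andP[h1 h2]; exists q.
    by rewrite /ball/= ltr_distl; apply/andP; split; lra.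
  have [q1 h1] := near_rat x.1.1; have [q2 h2] := near_rat x.1.2.
  have [q3 h3] := near_rat x.2.
  exists (q1, q2, q3, n) => //.
  have cx : ball (c (q1, q2, q3, n)) (e n) x by split.
  rewrite ifT//=; apply/asboolP => y cy; apply: xdU.
  rewrite (splitr d); apply: (@ball_triangle _ _ (c (q1, q2, q3, n))).
    by apply: (le_ball (ltW nd)); exact: ball_sym.
  exact: (le_ball (ltW nd)).
apply: countable_bigcupT_measurable => // -[[[q1 q2] q3] n].
case: ifPn => // _.
rewrite [X in measurable X](_ : _ = (ball (ratr q1 : R) (e n) `*`
  ball (ratr q2 : R) (e n)) `*` ball (ratr q3 : R) (e n)) //.
by apply: measurableX; [apply: measurableX|]; exact: measurable_ball.
Qed.

Lemma continuous_measurable_R3 (R : realType) (f : R * R * R -> R) :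
  continuous f -> measurable_fun (setT : set (M3 R)) f.
Proof.
move=> /continuousP cf; apply: (measurability _ (RGenOpens.measurableE R)).
move=> _ [_ [a [b ->] <-]]; rewrite setTI; apply: open_measurable_R3.
exact/cf/interval_open.
Qed.

(** Writing the inverse as $x\,(x^2)^{-1}$ reduces the claim to real powers of nonnegative numbers;
    at [0] both sides are [0]. *)
Lemma measurable_invr (R : realType) : measurable_fun setT (@GRing.inv R).
Proof.
rewrite (_ : GRing.inv = fun x : R => x * (x ^+ 2) `^ (-1)).
  apply: measurable_funM => //.
  exact: (measurableT_comp (measurable_powR _)).
apply/funext => x; rewrite powR_inv1 ?sqr_ge0//.
by have [->|x0] := eqVneq x 0; rewrite ?invr0 ?mul0r// expr2 invfM mulrA divff ?mul1r.
Qed.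

Lemma measurable_sqrtr (R : realType) : measurable_fun setT (@Num.sqrt R).
Proof. by apply: continuous_measurable_fun; exact: sqrt_continuous. Qed.

Lemma measurable_c1 (R : realType) : measurable_fun (setT : set (M3 R)) (@c1 R).
Proof. exact: (measurableT_comp (@measurable_fst _ _ _ _) (@measurable_fst _ _ _ _)). Qed.

Lemma measurable_c2 (R : realType) : measurable_fun (setT : set (M3 R)) (@c2 R).
Proof. exact: (measurableT_comp (@measurable_snd _ _ _ _) (@measurable_fst _ _ _ _)). Qed.

Lemma measurable_c3 (R : realType) : measurable_fun (setT : set (M3 R)) (@c3 R).
Proof. exact: (@measurable_snd _ _ _ _). Qed.

Definition vscale (R : realType) (a : R) (k : V3 R) : V3 R :=
  (a * c1 k, a * c2 k, a * c3 k).

Lemma measurable_vscale (R : realType) (a : R) :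
  measurable_fun setT (vscale a : M3 R -> M3 R).
Proof.
apply: measurable_fun_pair; [apply: measurable_fun_pair|].
- exact: (measurable_funM (measurable_cst a) (@measurable_c1 R)).
- exact: (measurable_funM (measurable_cst a) (@measurable_c2 R)).
- exact: (measurable_funM (measurable_cst a) (@measurable_c3 R)).
Qed.

(** * Monotonicity of the integral and dilations of Lebesgue measure *)

Section integral_monotone.
Local Open Scope ereal_scope.
Context d (T : measurableType d) (R : realType) (mu : {measure set T -> \bar R}).

(** A nonnegative integral is a supremum over the simple functions below the integrand. Arguing from
    this supremum makes the bound applicable to [normsq (Top r F k)], whose measurability is never
    established. *)
Lemma ge0_le_integralT (f g : T -> \bar R) :
  (forall x, 0 <= f x) -> (forall x, f x <= g x) ->
  \int[mu]_x f x <= \int[mu]_x g x.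
Proof.
move=> f0 fg; have g0 x : 0 <= g x by exact: le_trans (fg x).
rewrite !ge0_integralTE//; apply: le_ereal_sup => _ [h hf <-].
by exists h => // x; exact: le_trans (fg x).
Qed.

End integral_monotone.

Section scaling.
Local Open Scope ereal_scope.

(** The hypothesis says that [m] is [a] times its own image under [f]; the rest is the change of
    variables for an image measure. *)
Lemma ge0_integral_rescale d (T : measurableType d) (R : realType)
    (m : {measure set T -> \bar R}) (f : T -> T) (a : R) :
  (0 <= a)%R -> measurable_fun setT f ->
  (forall A, measurable A -> m A = a%:E * m (f @^-1` A)) ->
  forall g : T -> \bar R, measurable_fun setT g -> (forall x, 0 <= g x) ->
  \int[m]_x g x = a%:E * \int[m]_x g (f x).
Proof.
move=> a0 mf mE g mg g0.
pose m' : {measure set T -> \bar R} := mscale (NngNum a0) (pushforward m f).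
transitivity (\int[m' mf]_x g x).
  by apply: eq_measure_integral => A mA _; exact: mE.
by rewrite ge0_integral_mscale//= ge0_integral_pushforward.
Qed.

(** Sections of the preimage are preimages under [f2] of sections of [X], so the inner measure
    yields the factor [a2] and the outer integral the factor [a1]. *)
Lemma product_measure_rescale d1 d2 (T1 : measurableType d1) (T2 : measurableType d2)
    (R : realType) (m1 : {measure set T1 -> \bar R})
    (m2 : {sigma_finite_measure set T2 -> \bar R})
    (f1 : T1 -> T1) (f2 : T2 -> T2) (a1 a2 : R) :
  (0 <= a1)%R -> (0 <= a2)%R ->
  measurable_fun setT f1 -> measurable_fun setT f2 ->
  (forall A, measurable A -> m1 A = a1%:E * m1 (f1 @^-1` A)) ->
  (forall A, measurable A -> m2 A = a2%:E * m2 (f2 @^-1` A)) ->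
  forall X, measurable X ->
  (m1 \x m2) X = (a1 * a2)%:E * (m1 \x m2) ((fun x => (f1 x.1, f2 x.2)) @^-1` X).
Proof.
move=> a10 a20 mf1 mf2 H1 H2 X mX.
pose F (x : T1 * T2) := (f1 x.1, f2 x.2).
have mF : measurable_fun setT F.
  apply: measurable_fun_pair.
    exact: (measurableT_comp mf1).
  exact: (measurableT_comp mf2).
have mFX : measurable (F @^-1` X).
  by rewrite -[Y in measurable Y]setTI; exact: mF.
rewrite /product_measure1 EFinM -muleA -ge0_integralZl//; last exact: measurable_fun_xsection.
rewrite (ge0_integral_rescale a10 mf1 H1)//; last exact: measurable_fun_xsection.
congr (_ * _); apply: eq_integral => x _ /=.
rewrite H2; last exact: measurable_xsection.
congr (_ * m2 _); apply/seteqP; split=> y;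
  rewrite /xsection/= !inE.
Qed.

(** The rescaled image measure agrees with Lebesgue measure on half-open intervals, and these
    determine it. *)
Lemma lebesgue_measure_scale (R : realType) (a : R) (A : set R) :
  (0 < a)%R -> measurable A ->
  lebesgue_measure A = a%:E * lebesgue_measure (( *%R a) @^-1` A).
Proof.
move=> a0 mA.
pose f : measurableTypeR R -> measurableTypeR R := ( *%R a).
have mf : measurable_fun setT f by exact: mulrl_measurable.
pose m' : {measure set (measurableTypeR R) -> \bar R} :=
  mscale (NngNum (ltW a0)) (pushforward (@lebesgue_measure R) f).
rewrite (@lebesgue_measure_unique _ (m' mf))//.
move=> _ [[b c]] _ <-; rewrite /m'/= /mscale/= /pushforward.
rewrite (_ : f @^-1` `]b, c] = `]b / a, c / a]%classic)%R; last first.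
  apply/seteqP; split=> x /=; rewrite /f !in_itv/=;
  by rewrite ltr_pdivrMr// ler_pdivlMr// mulrC.
rewrite !lebesgue_measure_itv/= !lte_fin ltr_pM2r ?invr_gt0//.
case: ifPn => _; last by rewrite mule0.
by rewrite -!EFinB -EFinM -mulrBl mulrCA divff ?mulr1// gt_eqF.
Qed.

(** The product rule is used twice: for the plane with factor [a * a], then for the third
    coordinate. *)
Lemma leb3_scale (R : realType) (a : R) (X : set (M3 R)) :
  (0 < a)%R -> measurable X ->
  @leb3 R X = (a ^+ 3)%:E * @leb3 R (vscale a @^-1` X).
Proof.
move=> a0 mX.
have ma : measurable_fun setT (( *%R a) : measurableTypeR R -> measurableTypeR R).
  exact: mulrl_measurable.
have H1 A : measurable A ->
    lebesgue_measure A = a%:E * lebesgue_measure (( *%R a) @^-1` A).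
  exact: lebesgue_measure_scale.
have a2 : (0 <= a * a)%R by rewrite mulr_ge0 ?ltW.
have H2 := @product_measure_rescale _ _ _ _ _ (@lebesgue_measure R) (@lebesgue_measure R)
  _ _ a a (ltW a0) (ltW a0) ma ma H1 H1.
have m2 : measurable_fun setT (fun x : measurableTypeR R * measurableTypeR R =>
    ((a * x.1)%R : measurableTypeR R, (a * x.2)%R : measurableTypeR R)).
  by apply: measurable_fun_pair; exact: (measurableT_comp ma).
rewrite exprSr expr2.
exact: (@product_measure_rescale _ _ _ _ _ (@lebesgue_measure R \x @lebesgue_measure R)
  (@lebesgue_measure R) _ _ (a * a) a a2 (ltW a0) m2 ma H2 H1 X mX).
Qed.

Lemma leb3_integral_scale (R : realType) (a : R) (f : M3 R -> \bar R) :
  (0 < a)%R -> measurable_fun setT f -> (forall k, 0 <= f k) ->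
  \int[@leb3 R]_k f k =
  (a ^+ 3)%:E * \int[@leb3 R]_k f (vscale a k).
Proof.
move=> a0 mf f0.
have a3 : (0 <= a ^+ 3)%R by rewrite exprn_ge0// ltW.
apply: (@ge0_integral_rescale _ _ _ (@leb3 R) (vscale a) _ a3) => //.
  exact: measurable_vscale.
by move=> A mA; exact: leb3_scale.
Qed.

End scaling.

(** * Lipschitz bounds for oscillatory integrals *)

Lemma norm_cosB_le (R : realType) (a b : R) : `|cos a - cos b| <= `|a - b|.
Proof.
wlog ab : a b / b <= a.
  move=> H; have [/H//|/ltW/H] := leP b a.
  by rewrite distrC [X in _ <= X]distrC.
have cf : {within `[b, a], continuous (@cos R)}.
  by apply: continuous_subspaceT => x; exact: continuous_cos.
have [c _ ->] := @MVT_segment R cos (fun x => - sin x) b a ab (fun x _ => is_derive_cos x) cf.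
rewrite normrM ler_piMl// normrN ler_norml sin_geN1 sin_le1//.
Qed.

Lemma norm_sinB_le (R : realType) (a b : R) : `|sin a - sin b| <= `|a - b|.
Proof.
wlog ab : a b / b <= a.
  move=> H; have [/H//|/ltW/H] := leP b a.
  by rewrite distrC [X in _ <= X]distrC.
have cf : {within `[b, a], continuous (@sin R)}.
  by apply: continuous_subspaceT => x; exact: continuous_sin.
have [c _ ->] := @MVT_segment R sin cos b a ab (fun x _ => is_derive_sin x) cf.
by rewrite normrM ler_piMl// ler_norml cos_geN1 cos_le1.
Qed.

(** [Rintegral] sends every infinite value of the integral to [0], including the one assigned to
    $\infty-\infty$. A nonzero value therefore forces the positive and the negative part to have
    finite integrals. This turns $q\neq0$ into integrability of $j_0$. *)
Lemma Rintegral_neq0_integrable d (T : measurableType d) (R : realType)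
    (mu : {measure set T -> \bar R}) (f : T -> R) :
  measurable_fun setT f -> Rintegral mu setT f != 0 ->
  mu.-integrable setT (EFin \o f).
Proof.
move=> mf; rewrite /Rintegral integralE => f0.
have mF : measurable_fun setT (EFin \o f) by exact/measurable_EFinP.
have p0 : (0 <= \int[mu]_x ((EFin \o f)^\+ x))%E.
  by apply: integral_ge0 => x _; exact: funepos_ge0.
have n0 : (0 <= \int[mu]_x ((EFin \o f)^\- x))%E.
  by apply: integral_ge0 => x _; exact: funeneg_ge0.
apply/integrableP; split => //.
rewrite -[X in integral _ _ X]/(abse \o (EFin \o f)) fune_abse ge0_integralD//; last 2 first.
- exact: measurable_funepos.
- exact: measurable_funeneg.
move: f0 p0 n0; rewrite -/(EFin \o f).
case: (\int[mu]_x ((EFin \o f)^\+ x))%E => [p| |];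
  case: (\int[mu]_x ((EFin \o f)^\- x))%E => [n| |] //=; rewrite ?eqxx//.
by move=> *; rewrite ltry.
Qed.

Definition dist1 (R : realType) (k k' : V3 R) : R :=
  `|c1 k - c1 k'| + `|c2 k - c2 k'| + `|c3 k - c3 k'|.

Lemma abs_c_le_enorm (R : realType) (x : V3 R) :
  [/\ `|c1 x| <= enorm x, `|c2 x| <= enorm x & `|c3 x| <= enorm x].
Proof.
by split; rewrite /enorm -sqrtr_sqr ler_sqrt ?sqr_ge0//; rewrite /dot;
  nra.
Qed.

Lemma measurable_dot (R : realType) (k : V3 R) :
  measurable_fun (setT : set (M3 R)) (dot k).
Proof.
apply: measurable_funD; [apply: measurable_funD|]; apply: measurable_funM;
 rewrite ?measurable_cst//.
- exact: measurable_c1.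
- exact: measurable_c2.
- exact: measurable_c3.
Qed.

Section oscillatory_integral.
Context (R : realType) (phi : R -> R) (j : V3 R -> R).
Hypothesis phi_lip : forall a b, `|phi a - phi b| <= `|a - b|.
Hypothesis phi_le1 : forall a, `|phi a| <= 1.
Hypothesis phi_cont : continuous phi.
Hypothesis j_int : (@leb3 R).-integrable setT (EFin \o j).

Let osc_integrable (k : V3 R) :
  (@leb3 R).-integrable setT (EFin \o (fun x => phi (dot k x) * j x)).
Proof.
have mj : measurable_fun (setT : set (M3 R)) j.
  by apply/measurable_EFinP; case/integrableP: j_int.
apply: (le_integrable _ _ _ j_int) => //.
  apply/measurable_EFinP; apply: measurable_funM => //.
  apply: (measurableT_comp _ (measurable_dot k)).
  exact: continuous_measurable_fun.
by move=> x _ /=; rewrite lee_fin normrM ler_piMl.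
Qed.

(** Where [j] is nonzero all coordinates of [x] are at most [M] in absolute value, so the phases
    $k\cdot x$ and $k'\cdot x$ differ by at most [M] times the $\ell^1$ distance [dist1 k k']. The
    bound is integrated against $|j|$; [M] may be negative, hence the absolute value in the
    constant. *)
Lemma oscillatory_integral_lipschitz (M : R) :
  (forall x, M < enorm x -> j x = 0) ->
  exists2 L, 0 <= L & forall k k',
    `|Rintegral (@leb3 R) setT (fun x => phi (dot k x) * j x) -
      Rintegral (@leb3 R) setT (fun x => phi (dot k' x) * j x)| <= L * dist1 k k'.
Proof.
move=> jM.
pose I := Rintegral (@leb3 R) setT (fun x => `|j x|).
have I0 : 0 <= I by apply: Rintegral_ge0.
exists (`|M| * I) => [|k k']; first by rewrite mulr_ge0.
rewrite -RintegralB//.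
have absj_int : (@leb3 R).-integrable setT (EFin \o (fun x => `|j x|)).
  exact: (integrable_abse j_int).
have int_diff : (@leb3 R).-integrable setT
    (EFin \o (fun x => phi (dot k x) * j x - phi (dot k' x) * j x)).
  exact: (integrableB _ (osc_integrable k) (osc_integrable k')).
apply: le_trans (le_normr_Rintegral _ _) _ => //.
rewrite mulrAC -RintegralZl//.
apply: le_Rintegral => //.
- exact: (integrable_abse int_diff).
- exact: (integrableZl _ (`|M| * dist1 k k') absj_int).
move=> x _; rewrite -mulrBl normrM.
have [xM|/jM ->] := leP (enorm x) M; last by rewrite normr0 !mulr0.
rewrite ler_wpM2r//; apply: le_trans (phi_lip _ _) _.
have [h1 h2 h3] := abs_c_le_enorm x.
have -> : dot k x - dot k' x =
    c1 x * (c1 k - c1 k') + c2 x * (c2 k - c2 k') + c3 x * (c3 k - c3 k').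
  by rewrite /dot; ring.
have hM : enorm x <= `|M| by apply: le_trans xM _; exact: ler_norm.
rewrite /dist1 [X in _ <= X]mulrDr (mulrDr _ `|_|); apply: le_trans (ler_normD _ _) _; apply: lerD.
  by apply: le_trans (ler_normD _ _) _; apply: lerD; rewrite normrM ler_wpM2r//;
   [exact: le_trans h1 hM|exact: le_trans h2 hM].
by rewrite normrM ler_wpM2r//; exact: le_trans h3 hM.
Qed.

End oscillatory_integral.

(** * Scaling of vectors and the action of $T_r$ on a single shell *)

Lemma enorm_vscale (R : realType) (a : R) (k : V3 R) :
  0 <= a -> enorm (vscale a k) = a * enorm k.
Proof.
move=> a0; rewrite /enorm.
have -> : dot (vscale a k) (vscale a k) = a ^+ 2 * dot k k.
  by rewrite /dot /vscale /c1 /c2 /c3/=; ring.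
by rewrite sqrtrM ?sqr_ge0// sqrtr_sqr ger0_norm.
Qed.

Lemma khat_vscale (R : realType) (a : R) (k : V3 R) :
  0 < a -> khat (vscale a k) = khat k.
Proof.
move=> a0; rewrite /khat enorm_vscale ?ltW// /vscale /c1 /c2 /c3/=.
have h (x : R) : a * x / (a * enorm k) = x / enorm k.
  by rewrite -mulf_div divff ?mul1r// gt_eqF.
by rewrite !h.
Qed.

Section shell.
Context (R : realType).
Implicit Types (k : V3 R) (i n : nat).

Lemma measurable_enorm : measurable_fun (setT : set (M3 R)) (@enorm R).
Proof.
apply: (measurableT_comp (@measurable_sqrtr R)).
have ? := @measurable_c1 R; have ? := @measurable_c2 R; have ? := @measurable_c3 R.
by do !apply: measurable_funD; exact: measurable_funM.
Qed.

Lemma measurable_khat : measurable_fun (setT : set (M3 R)) (@khat R : M3 R -> M3 R).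
Proof.
have h (c : M3 R -> R) : measurable_fun setT c ->
    measurable_fun setT (fun k => c k / enorm k).
  move=> mc; apply: measurable_funM => //.
  exact: (measurableT_comp (@measurable_invr R) measurable_enorm).
apply: measurable_fun_pair; [apply: measurable_fun_pair|].
- exact: h (@measurable_c1 R).
- exact: h (@measurable_c2 R).
- exact: h (@measurable_c3 R).
Qed.

Lemma measurable_cpow m :
  measurable_fun (setT : set (M3 R)) (fun u => (cpow (c1 u) (c2 u) m).1) /\
  measurable_fun (setT : set (M3 R)) (fun u => (cpow (c1 u) (c2 u) m).2).
Proof.
have m1 := @measurable_c1 R; have m2 := @measurable_c2 R.
elim: m => [|m [ih1 ih2]] /=; first by split; exact: measurable_cst.
split; [apply: measurable_funB|apply: measurable_funD]; exact: measurable_funM.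
Qed.

Lemma measurable_Yreal l m : measurable_fun (setT : set (M3 R)) (@Yreal R l m).
Proof.
apply: measurable_funM.
  apply: (measurableT_comp _ (@measurable_c3 R)).
  by apply: continuous_measurable_fun; exact: continuous_horner.
have [h1 h2] := measurable_cpow (uphalf m).
by case: (odd m || (m == 0)%N).
Qed.

(** The common shape of all functions in the span onto which $Q_i$ projects. Measurability of [A] is
    recorded because the minorants integrated later are built from it. *)
Definition angular i (f : V3 R -> R) := exists2 A : M3 R -> R,
  measurable_fun setT A & forall k, f k = zeta0 i (enorm k) * A (khat k).

Lemma angular_Qfamily i n : angular i (nth (fun _ => 0) (@Qfamily R i) n).
Proof.
(* An index past the end of the list returns the default, the zero function, which must have this
   shape too. *)
have a0 : angular i (fun _ => 0).
  by exists (cst 0) => [|k]; rewrite ?mulr0//; exact: measurable_cst.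
rewrite /Qfamily; set G := (G in map G _).
have hG l p : angular i (nth (fun _ => 0) (G l) p).
  rewrite /G; elim: (iota 0 _) p => [|m ms ihm] [|p]//=.
  by exists (Yreal l m) => //; exact: measurable_Yreal.
elim: (iota 0 i.+1) n => [|l ls ih] n; first by rewrite nth_nil.
by rewrite map_cons -[flatten _]/(G l ++ flatten _) nth_cat; case: ifP.
Qed.

(** Whatever coefficients [xget] selects, the result is a linear combination of the family, and the
    radial factor can be pulled out of the sum. *)
Lemma angular_Qproj i (h : V3 R -> R) : angular i (Qproj i h).
Proof.
rewrite /Qproj; set c := xget _ _; set fs := Qfamily R i.
have /choice[A hA] : forall n, exists A : M3 R -> R, measurable_fun setT A /\
    forall k, nth (fun _ => 0) fs n k = zeta0 i (enorm k) * A (khat k).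
  by move=> n; have [A mA hA] := angular_Qfamily i n; exists A.
exists (fun u => \sum_(n < size fs) nth 0 c n * A n u).
  apply: measurable_sum => n; apply: measurable_funM; first exact: measurable_cst.
  by case: (hA n).
move=> k; rewrite /lincomb mulr_sumr; apply: eq_bigr => n _.
by rewrite (hA n).2 mulrCA.
Qed.

Lemma eps_gt0 i : 0 < eps R i.
Proof. by rewrite /eps exprn_gt0// invr_gt0. Qed.

Lemma eps_le m n : (m <= n)%N -> eps R n <= eps R m.
Proof.
move=> mn; rewrite /eps ler_wiXn2l//; first by rewrite invf_le1// ler1n.
(* [eps] contains [i.-1], so the indices [0] and [1] give the same value. *)
by case: m n mn => [|m] [|n].
Qed.

Lemma zeta0_shell n (t : R) : eps R n.+1 < t -> t < eps R n ->
  zeta0 n t = powR (ln 2) (- (1 / 2)) * powR t (- (3 / 2)).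
Proof. by move=> h1 h2; rewrite /zeta0 !ltW. Qed.

(** The strict inequalities matter: neighbouring closed shells share their common radius. *)
Lemma zeta0_other_shell n m (t : R) : eps R n.+1 < t -> t < eps R n -> m != n ->
  zeta0 m t = 0.
Proof.
move=> h1 h2; rewrite /zeta0 neq_ltn => /orP[mn|nm].
  by rewrite leNgt (lt_le_trans h2 (eps_le mn)).
by rewrite andbC leNgt (le_lt_trans (eps_le nm) h1).
Qed.

Lemma limn_sum_single (u : nat -> R) n : (0 < n)%N ->
  (forall i, i != n -> u i = 0) ->
  limn (fun N => \sum_(1 <= i < N) u i) = u n.
Proof.
move=> n0 un; apply: lim_near_cst => //.
(* The upper index [N] is excluded from the sum, so the partial sums are constant from [n.+1] on. *)
exists n.+1 => // N /= nN.
rewrite (bigD1_seq n)/= ?iota_uniq ?mem_index_iota ?n0//.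
by rewrite big1_seq ?addr0// => i /andP[/un].
Qed.

(** All terms of the series but the [n]-th vanish on the open shell. [A] and [B] collect the angular
    parts of the two projections together with $b_n^{-1}-1$, $b_n-1$ and $(\log 2)^{-1/2}$; they
    depend on [F] but, within the shell, only on the direction of [k]. *)
Lemma Top_shell (r : R) (F : cfun R) n : (0 < n)%N ->
  exists A B : M3 R -> R, [/\ measurable_fun setT A, measurable_fun setT B &
  forall k, eps R n.+1 < enorm k -> enorm k < eps R n ->
   Top r F k =
    ((F k).1 + enorm k `^ (- (3 / 2)) *
       (A (khat k) * cos (enorm k * tau r n) + B (khat k) * sin (enorm k * tau r n)),
     (F k).2 + enorm k `^ (- (3 / 2)) *
       (- A (khat k) * sin (enorm k * tau r n) + B (khat k) * cos (enorm k * tau r n)))].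
Proof.
move=> n0.
pose ReU i k' := (F k').1 * cos (enorm k' * tau r i) - (F k').2 * sin (enorm k' * tau r i).
pose ImU i k' := (F k').1 * sin (enorm k' * tau r i) + (F k').2 * cos (enorm k' * tau r i).
have [A mA hA] := angular_Qproj n (ReU n).
have [B mB hB] := angular_Qproj n (ImU n).
pose l : R := powR (ln 2) (- (1 / 2)).
exists (fun u => ((bb R n)^-1 - 1) * l * A u), (fun u => (bb R n - 1) * l * B u); split.
- by apply: measurable_funM => //; exact: measurable_cst.
- by apply: measurable_funM => //; exact: measurable_cst.
move=> k h1 h2.
have other i : i != n -> Tterm r F i k = (0, 0).
  move=> ni; rewrite /Tterm.
  have [A' _ ->] := angular_Qproj i (ReU i).
  have [B' _ ->] := angular_Qproj i (ImU i).
  by rewrite (zeta0_other_shell h1 h2 ni) !(mul0r,mulr0,oppr0,addr0).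
rewrite /Top !(@limn_sum_single _ n) ?n0//; last 2 first.
- by move=> i /other ->.
- by move=> i /other ->.
rewrite /Tterm -/(ReU n) -/(ImU n) hA hB (zeta0_shell h1 h2) /=.
by congr pair; rewrite -/l; ring.
Qed.

End shell.

(** * The lower bound for two points with different phases *)

(* Rotating both vectors by their phases turns the common part into the constant
   vector (A, B), which cancels in the difference. *)
Lemma phase_gap (R : realType) (W q eta A B f1 f2 g1 g2 th th' : R) :
  `|f1 - q| <= eta -> `|f2| <= eta -> `|g1 - q| <= eta -> `|g2| <= eta ->
  W ^+ 2 * (q ^+ 2 * (1 - cos (th' - th)) - 32 * eta ^+ 2) / 2 <=
  ((- f2 * W + (A * cos th + B * sin th)) ^+ 2 +
   (f1 * W + (- A * sin th + B * cos th)) ^+ 2) +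
  ((- g2 * W + (A * cos th' + B * sin th')) ^+ 2 +
   (g1 * W + (- A * sin th' + B * cos th')) ^+ 2).
Proof.
move=> hf1 hf2 hg1 hg2; rewrite cosB.
have rot c s x y : c ^+ 2 + s ^+ 2 = 1 :> R ->
    x ^+ 2 + y ^+ 2 = (x * c - y * s) ^+ 2 + (x * s + y * c) ^+ 2.
  by move=> cs; rewrite -[LHS]mulr1 -cs; ring.
rewrite [X in _ <= X + _](rot _ _ _ _ (cos2Dsin2 th)).
rewrite [X in _ <= _ + X](rot _ _ _ _ (cos2Dsin2 th')).
have cs := cos2Dsin2 th; have cs' := cos2Dsin2 th'.
have [c1 s1] : `|cos th| <= 1 /\ `|sin th| <= 1.
  by rewrite !ler_norml cos_geN1 cos_le1 sin_geN1 sin_le1.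
have [c1' s1'] : `|cos th'| <= 1 /\ `|sin th'| <= 1.
  by rewrite !ler_norml cos_geN1 cos_le1 sin_geN1 sin_le1.
move: (cos th) (sin th) (cos th') (sin th') cs cs' c1 s1 c1' s1' => c s c' s' cs cs' hc hs hc' hs'.
have -> : (- f2 * W + (A * c + B * s)) * c - (f1 * W + (- A * s + B * c)) * s =
    W * (- f2 * c - f1 * s) + A.
  transitivity (W * (- f2 * c - f1 * s) + A * (c ^+ 2 + s ^+ 2)); first by ring.
  by rewrite cs mulr1.
have -> : (- f2 * W + (A * c + B * s)) * s + (f1 * W + (- A * s + B * c)) * c =
    W * (- f2 * s + f1 * c) + B.
  transitivity (W * (- f2 * s + f1 * c) + B * (c ^+ 2 + s ^+ 2)); first by ring.
  by rewrite cs mulr1.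
have -> : (- g2 * W + (A * c' + B * s')) * c' - (g1 * W + (- A * s' + B * c')) * s' =
    W * (- g2 * c' - g1 * s') + A.
  transitivity (W * (- g2 * c' - g1 * s') + A * (c' ^+ 2 + s' ^+ 2)); first by ring.
  by rewrite cs' mulr1.
have -> : (- g2 * W + (A * c' + B * s')) * s' + (g1 * W + (- A * s' + B * c')) * c' =
    W * (- g2 * s' + g1 * c') + B.
  transitivity (W * (- g2 * s' + g1 * c') + B * (c' ^+ 2 + s' ^+ 2)); first by ring.
  by rewrite cs' mulr1.
(* [E1] and [E2] are the errors made by replacing the pairs [(f1, f2)] and [(g1, g2)] by [(q, 0)];
   each is a sum of four products bounded by [eta]. *)
pose E1 := (- g2 * c' - (g1 - q) * s') - (- f2 * c - (f1 - q) * s).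
pose E2 := (- g2 * s' + (g1 - q) * c') - (- f2 * s + (f1 - q) * c).
have small x y : `|x| <= eta -> `|y| <= 1 -> `|x * y| <= eta.
  by move=> hx hy; rewrite normrM -[leRHS]mulr1; exact: ler_pM.
have eta0 : 0 <= eta by exact: le_trans hf2.
have := small _ _ hf2 hc; have := small _ _ hf2 hs.
have := small _ _ hg2 hc'; have := small _ _ hg2 hs'.
have := small _ _ hf1 hc; have := small _ _ hf1 hs.
have := small _ _ hg1 hc'; have := small _ _ hg1 hs'.
rewrite !ler_norml => /andP[u1 v1] /andP[u2 v2] /andP[u3 v3] /andP[u4 v4]
  /andP[u5 v5] /andP[u6 v6] /andP[u7 v7] /andP[u8 v8].
have sq16 x : - (4 * eta) <= x -> x <= 4 * eta -> x ^+ 2 <= 16 * eta ^+ 2.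
  by move=> *; nra.
have hE1 : E1 ^+ 2 <= 16 * eta ^+ 2 by apply: sq16; rewrite /E1; lra.
have hE2 : E2 ^+ 2 <= 16 * eta ^+ 2 by apply: sq16; rewrite /E2; lra.
set X := W * (- f2 * c - f1 * s) + A; set Y := W * (- f2 * s + f1 * c) + B.
set X' := W * (- g2 * c' - g1 * s') + A; set Y' := W * (- g2 * s' + g1 * c') + B.
have dX : X' - X = W * (- q * (s' - s) + E1) by rewrite /X /X' /E1; ring.
have dY : Y' - Y = W * (q * (c' - c) + E2) by rewrite /Y /Y' /E2; ring.
(* Parallelogram inequality: two vectors that are far apart cannot both be short. *)
have : (X' - X) ^+ 2 + (Y' - Y) ^+ 2 <= 2 * (X ^+ 2 + Y ^+ 2 + (X' ^+ 2 + Y' ^+ 2)).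
  by have := sqr_ge0 (X' + X); have := sqr_ge0 (Y' + Y); nra.
have half x y : x ^+ 2 / 2 - y ^+ 2 <= (x + y) ^+ 2 :> R.
  by have := sqr_ge0 (x + 2 * y); nra.
(* The squared chord between two points of the unit circle is $2(1-\cos(\theta'-\theta))$. *)
have gap : q ^+ 2 * (1 - (c' * c + s' * s)) =
   ((- q * (s' - s)) ^+ 2 + (q * (c' - c)) ^+ 2) / 2.
  have -> : ((- q * (s' - s)) ^+ 2 + (q * (c' - c)) ^+ 2) / 2 =
    q ^+ 2 * ((c ^+ 2 + s ^+ 2 + (c' ^+ 2 + s' ^+ 2)) / 2 - (c' * c + s' * s)) by field.
  by rewrite cs cs'; field.
rewrite dX dY !exprMn gap => H.
have h1 := half (- q * (s' - s)) E1; have h2 := half (q * (c' - c)) E2.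
have W0 := sqr_ge0 W.
set S := X ^+ 2 + Y ^+ 2 + (X' ^+ 2 + Y' ^+ 2) in H *.
have : W ^+ 2 * (((- q * (s' - s)) ^+ 2 + (q * (c' - c)) ^+ 2) / 2 - 32 * eta ^+ 2)
   <= W ^+ 2 * ((- q * (s' - s) + E1) ^+ 2 + (q * (c' - c) + E2) ^+ 2).
  by apply: ler_wpM2l => //; lra.
move=> H2; rewrite ler_pdivrMr// [leRHS]mulrC; apply: le_trans H2 _.
by rewrite mulrDr.
Qed.

(** * Directions, velocities and cubes inside a shell *)

Section geometry.
Context (R : realType).
Implicit Types (u v k : V3 R).

Lemma enorm_ge0 k : 0 <= enorm k. Proof. exact: sqrtr_ge0. Qed.

Lemma dotxx_ge0 k : 0 <= dot k k.
Proof. by rewrite /dot; nra. Qed.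

Lemma enorm_sqr k : enorm k ^+ 2 = dot k k.
Proof. by rewrite sqr_sqrtr// dotxx_ge0. Qed.

Lemma dot_khat_khat k : 0 < enorm k -> dot (khat k) (khat k) = 1.
Proof.
move=> k0; rewrite /khat /dot /mkV /c1/= /c2/= /c3/=.
have -> : k.1.1 / enorm k * (k.1.1 / enorm k) + k.1.2 / enorm k * (k.1.2 / enorm k) +
  k.2 / enorm k * (k.2 / enorm k) = dot k k / enorm k ^+ 2.
  by rewrite /dot /c1 /c2 /c3; field; rewrite gt_eqF.
by rewrite enorm_sqr divff// -enorm_sqr sqrf_eq0 gt_eqF.
Qed.

(** Expanding $|u\pm v|^2\ge0$ gives $2|u\cdot v|\le 1+|v|^2<2$. *)
Lemma dot_lt1 u v : dot u u = 1 -> enorm v < 1 -> `|dot u v| < 1.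
Proof.
move=> u1 v1; have v2 : dot v v < 1.
  by rewrite -enorm_sqr expr_lt1// enorm_ge0.
move: u1 v2; rewrite /dot ltr_norml => u1 v2; apply/andP; split.
  have := sqr_ge0 (c1 u + c1 v); have := sqr_ge0 (c2 u + c2 v).
  by have := sqr_ge0 (c3 u + c3 v); nra.
have := sqr_ge0 (c1 u - c1 v); have := sqr_ge0 (c2 u - c2 v).
by have := sqr_ge0 (c3 u - c3 v); nra.
Qed.

Definition velocity_gap (vin vout u : V3 R) : R :=
  (1 - dot u vout)^-1 - (1 - dot u vin)^-1.

Definition vsub u v : V3 R := (c1 u - c1 v, c2 u - c2 v, c3 u - c3 v).

(** The difference of the two inverses has numerator $u\cdot(v^{out}-v^{in})$ and denominator
    $(1-u\cdot v^{out})(1-u\cdot v^{in})$, whose factors lie strictly between [0] and [2]. *)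
Lemma velocity_gap_lower vin vout u : enorm vin < 1 -> enorm vout < 1 ->
  dot u u = 1 -> `|dot u (vsub vout vin)| / 4 <= `|velocity_gap vin vout u|.
Proof.
move=> h1 h2 u1.
have := dot_lt1 u1 h1; have := dot_lt1 u1 h2.
rewrite !ltr_norml => /andP[a1 a2] /andP[b1 b2].
have p1 : 0 < 1 - dot u vout by rewrite subr_gt0.
have p2 : 0 < 1 - dot u vin by rewrite subr_gt0.
have -> : velocity_gap vin vout u =
    dot u (vsub vout vin) / ((1 - dot u vout) * (1 - dot u vin)).
  have -> : dot u (vsub vout vin) = dot u vout - dot u vin.
    by rewrite /dot /vsub /c1 /c2 /c3/=; ring.
  by rewrite /velocity_gap; field; rewrite !gt_eqF.
have p12 : 0 < (1 - dot u vout) * (1 - dot u vin) by exact: mulr_gt0.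
rewrite normrM ler_wpM2l// normfV (gtr0_norm p12) lef_pV2 ?posrE//.
by nra.
Qed.

(** The centre [e * k0] and the half-side [e * d] both scale with [e], so the cubes in different
    shells are dilates of one another. *)
Definition cube (k0 : V3 R) (e d : R) : set (M3 R) :=
  (`]e * c1 k0 - e * d, e * c1 k0 + e * d[ `*` `]e * c2 k0 - e * d, e * c2 k0 + e * d[) `*`
  `]e * c3 k0 - e * d, e * c3 k0 + e * d[.

Lemma measurable_cube k0 e d : measurable (cube k0 e d).
Proof. by do 2?apply: measurableX; exact: measurable_itv. Qed.

Lemma leb3_cube k0 e d : 0 < e -> 0 < d ->
  @leb3 R (cube k0 e d) = ((2 * e * d) ^+ 3)%:E.
Proof.
move=> e0 d0; have ed : 0 < e * d by rewrite mulr_gt0.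
have h (x : R) : @lebesgue_measure R `]x - e * d, x + e * d[ = (2 * e * d)%:E.
  rewrite lebesgue_measure_itv/= lte_fin ifT; last by lra.
  by rewrite -EFinB; congr EFin; ring.
rewrite /leb3 /cube product_measure1E//=; last exact: measurableX.
by rewrite product_measure1E//= !h -!EFinM; congr EFin; ring.
Qed.

(* The factors 7/12 and 1/100 keep the cube inside 1/2 < |k| / e < 2/3. *)
Lemma cube_geometry (d : V3 R) (k0 := vscale (7 / (12 * enorm d)) d) (e : R) k :
  0 < enorm d -> 0 < e -> cube k0 e (1 / 100) k ->
  [/\ e / 2 < enorm k, enorm k < 2 / 3 * e & enorm d / 2 <= `|dot (khat k) d|].
Proof.
move=> N0 e0 [[h1 h2] h3].
pose N := enorm d.
pose u1 := c1 d / N; pose u2 := c2 d / N; pose u3 := c3 d / N.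
(* In units of [e] the point is [7/12] times the unit vector along [d] plus an offset [a] with
   coordinates below [1/100]; [7/12] is the midpoint of [1/2] and [2/3]. *)
have uu : u1 ^+ 2 + u2 ^+ 2 + u3 ^+ 2 = 1.
  by have := dot_khat_khat N0; rewrite /dot /khat /mkV /c1/= /c2/= /c3/= !expr2.
pose a1 := c1 k / e - 7 / 12 * u1; pose a2 := c2 k / e - 7 / 12 * u2.
pose a3 := c3 k / e - 7 / 12 * u3.
have Nn0 : N != 0 by rewrite gt_eqF.
have en0 : e != 0 by rewrite gt_eqF.
have cc (x y z : R) : x = e * (7 / (12 * N) * y) ->
    `]x - e * (1 / 100), x + e * (1 / 100)[%classic z ->
    `|z / e - 7 / 12 * (y / N)| < 1 / 100.
  move=> ->; rewrite /= in_itv/= => /andP[l1 l2].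
  have -> : z / e - 7 / 12 * (y / N) = (z - e * (7 / (12 * N) * y)) / e.
    by field; rewrite Nn0 en0.
  rewrite normrM normfV (gtr0_norm e0) ltr_pdivrMr// ltr_norml.
  by apply/andP; split; lra.
have b1 : `|a1| < 1 / 100 := cc _ _ _ erefl h1.
have b2 : `|a2| < 1 / 100 := cc _ _ _ erefl h2.
have b3 : `|a3| < 1 / 100 := cc _ _ _ erefl h3.
have ke : k = vscale e (7 / 12 * u1 + a1, 7 / 12 * u2 + a2, 7 / 12 * u3 + a3).
  have e1 : e * (7 / 12 * u1 + a1) = c1 k by rewrite /a1; field; rewrite en0.
  have e2 : e * (7 / 12 * u2 + a2) = c2 k by rewrite /a2; field; rewrite en0.
  have e3 : e * (7 / 12 * u3 + a3) = c3 k by rewrite /a3; field; rewrite en0.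
  rewrite /vscale {1}/c1 {1}/c2 {1}/c3/= e1 e2 e3.
  by case: (k) => -[].
have le1 (x y z : R) : x ^+ 2 + y ^+ 2 + z ^+ 2 = 1 -> `|x| <= 1.
  by move=> h; rewrite -(@expr_le1 _ 2)// real_normK ?num_real// -h; nra.
have prod (x y : R) : `|x| <= 1 -> `|y| < 1 / 100 -> - (1 / 100) <= x * y <= 1 / 100.
  by move=> hx hy; rewrite -ler_norml normrM -[leRHS]mul1r ler_pM// ltW.
have /andP[p1 q1] := prod u1 a1 (le1 _ _ _ uu) b1.
have /andP[p2 q2] : - (1 / 100) <= u2 * a2 <= 1 / 100.
  by apply: prod b2; apply: (le1 _ u1 u3); rewrite -uu; ring.
have /andP[p3 q3] : - (1 / 100) <= u3 * a3 <= 1 / 100.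
  by apply: prod b3; apply: (le1 _ u1 u2); rewrite -uu; ring.
have sq (x : R) : `|x| < 1 / 100 -> x ^+ 2 <= 1 / 100.
  move=> hx; rewrite -real_normK ?num_real// expr2.
  by apply: le_trans (ler_pM _ _ (ltW hx) (ltW hx)) _ => //; lra.
have r1 := sq _ b1; have r2 := sq _ b2; have r3 := sq _ b3.
have s1 := sqr_ge0 a1; have s2 := sqr_ge0 a2; have s3 := sqr_ge0 a3.
set h := (_, _, _) in ke.
(* Since $|u\cdot a|\le 3/100$ and $|a|^2\le 3/100$, this value stays strictly between [1/4] and
   [4/9]. *)
have hh : dot h h = 49 / 144 * (u1 ^+ 2 + u2 ^+ 2 + u3 ^+ 2) +
   7 / 6 * (u1 * a1 + u2 * a2 + u3 * a3) + (a1 ^+ 2 + a2 ^+ 2 + a3 ^+ 2).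
  by rewrite /dot /c1 /c2 /c3/=; field.
rewrite uu in hh.
have hd : dot h d = N * (7 / 12 * (u1 ^+ 2 + u2 ^+ 2 + u3 ^+ 2) +
    (u1 * a1 + u2 * a2 + u3 * a3)).
  by rewrite /dot /h /u1 /u2 /u3 /c1 /c2 /c3/=; field; rewrite Nn0.
rewrite uu in hd.
have hn1 : 1 / 2 < enorm h.
  rewrite -[X in X < _]ger0_norm// -sqrtr_sqr ltr_sqrt; lra.
have hn2 : enorm h < 2 / 3.
  rewrite -[X in _ < X]ger0_norm// -sqrtr_sqr ltr_sqrt; lra.
have hnp : 0 < enorm h by lra.
rewrite ke (enorm_vscale _ (ltW e0)) khat_vscale//; split; [by nra|by nra|].
have -> : dot (khat h) d = dot h d / enorm h.
  by rewrite /dot /khat /mkV /c1/= /c2/= /c3/=; ring.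
rewrite normrM normfV (gtr0_norm hnp) ler_pdivlMr// hd normrM (gtr0_norm N0).
set v := 7 / 12 * 1 + _; have hv : 1 / 2 <= v by rewrite /v; lra.
rewrite (@ger0_norm _ v); last by lra.
rewrite [leRHS]mulrC (_ : enorm d / 2 * enorm h = enorm h / 2 * enorm d); last by ring.
by rewrite ler_pM2r//; lra.
Qed.

End geometry.

(** * Power and cosine estimates *)

Lemma powR_N32_sqr (R : realType) (x : R) : 0 < x -> (x `^ (- (3 / 2))) ^+ 2 = (x ^+ 3)^-1.
Proof.
move=> x0; rewrite -powR_mulrn ?powR_ge0// -powRrM.
have -> : - (3 / 2) * 2%:R = - 3%:R :> R by field.
by rewrite powRN powR_mulrn// ltW.
Qed.

(** The interval from [1/4] to [1/3] contains $|k|/(2e)$ when $e/2<|k|<2e/3$, and the cosine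
    decreases there because $\pi\ge2$. *)
Lemma cos_gap (R : realType) (t : R) : 1 / 4 <= t -> t <= 1 / 3 ->
  1 - cos (1 / 4) <= 1 - cos t.
Proof.
move=> t1 t2; have p2 := pi_ge2 R.
rewrite lerD2l lerN2; move: t1; rewrite le_eqVlt => /predU1P[->//|t1].
by apply: ltW; rewrite ltr_cos// in_itv/=; apply/andP; split; lra.
Qed.

Lemma cos_quarter_lt1 (R : realType) : 0 < 1 - cos (1 / 4) :> R.
Proof.
have p2 := pi_ge2 R.
by rewrite subr_gt0 -[X in _ < X]cos0 ltr_cos ?in_itv/=;
  [lra|apply/andP; split; lra|apply/andP; split; lra].
Qed.

(** * Continuity of the Fourier transform and its value at the origin *)

Section Fourier.
Context (R : realType).
Implicit Types (k : V3 R).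

Lemma dist1_lipschitz_continuous (f : R * R * R -> R) (L : R) : 0 <= L ->
  (forall k k', `|f k - f k'| <= L * dist1 k k') -> continuous f.
Proof.
move=> L0 fL x; apply/cvgrPdist_lt => e e0.
(* In a sup-norm ball [dist1] is at most three times the radius; the [+ 1] covers [L = 0] and makes
   the final inequality strict. *)
have d0 : 0 < e / (3 * L + 1) by rewrite divr_gt0//; lra.
apply: filterS (nbhsx_ballx x _ d0) => y [[b1 b2] b3].
apply: le_lt_trans (fL _ _) _.
have : dist1 x y <= 3 * (e / (3 * L + 1)).
  move: b1 b2 b3; rewrite /dist1 /ball/= /c1 /c2 /c3 => b1 b2 b3.
  by move/ltW: b1; move/ltW: b2; move/ltW: b3; lra.
move=> /(ler_wpM2l L0) /le_lt_trans; apply.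
rewrite (_ : L * _ = 3 * L * e / (3 * L + 1)); last by ring.
rewrite ltr_pdivrMr; last by lra.
by rewrite mulrC ltr_pM2l//; lra.
Qed.

Lemma FT_lipschitz (j : V3 R -> R) : test_function j ->
  Rintegral (@leb3 R) setT j != 0 ->
  exists2 L, 0 <= L & forall k k',
   `|(FT j k).1 - (FT j k').1| <= L * dist1 k k' /\
   `|(FT j k).2 - (FT j k').2| <= L * dist1 k k'.
Proof.
move=> [sj [M jM]] j0.
have mj : measurable_fun (setT : set (M3 R)) j.
  by apply: continuous_measurable_R3; exact: (sj [::]).1.
have j_int := Rintegral_neq0_integrable mj j0.
have cos1 (a : R) : `|cos a| <= 1 by rewrite ler_norml cos_geN1 cos_le1.
have sin1 (a : R) : `|sin a| <= 1 by rewrite ler_norml sin_geN1 sin_le1.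
have [L1 L10 h1] := oscillatory_integral_lipschitz (@norm_cosB_le R) cos1
  (@continuous_cos R) j_int jM.
have [L2 L20 h2] := oscillatory_integral_lipschitz (@norm_sinB_le R) sin1
  (@continuous_sin R) j_int jM.
pose c : R := (2 * pi) `^ (- (3 / 2)).
have c0 : 0 <= c by exact: powR_ge0.
exists (c * (L1 + L2)) => [|k k']; first by rewrite mulr_ge0// addr_ge0.
have d0 : 0 <= dist1 k k' by rewrite /dist1 !addr_ge0.
rewrite /FT/= -/c; split.
  rewrite -mulrBr normrM (ger0_norm c0) -mulrA ler_wpM2l//.
  by apply: le_trans (h1 _ _) _; rewrite ler_wpM2r// lerDl.
rewrite -opprD normrN -mulrBr normrM (ger0_norm c0) -mulrA ler_wpM2l//.
by apply: le_trans (h2 _ _) _; rewrite ler_wpM2r// lerDr.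
Qed.

Lemma FT_at0 (j : V3 R -> R) : FT j (0, 0, 0) =
  ((2 * pi) `^ (- (3 / 2)) * Rintegral (@leb3 R) setT j, 0).
Proof.
have d0 x : dot ((0, 0, 0) : V3 R) x = 0.
  by rewrite /dot /c1 /c2 /c3/= !mul0r !addr0.
rewrite /FT; congr pair.
  by congr (_ * _); apply: eq_Rintegral => x _; rewrite d0 cos0 mul1r.
rewrite [X in _ * X](_ : _ = 0) ?mulr0 ?oppr0//.
by rewrite /Rintegral integral0_eq// => x _; rewrite d0 sin0 mul0r.
Qed.

Lemma eps_to0 (e : R) : 0 < e -> exists2 n0, (0 < n0)%N & forall n, (n0 <= n)%N -> eps R n <= e.
Proof.
move=> e0.
have /cvgrPdist_lt/(_ e e0)[N _ hN] : (2^-1 : R) ^+ n @[n --> \oo] --> (0 : R).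
  by apply: cvg_expr; rewrite ger0_norm ?invr_ge0// invf_lt1// ltr1n.
(* The shift by one is that of the exponent in [eps]. *)
exists N.+1 => // -[//|n] nN.
have := hN n nN; rewrite /= sub0r normrN ger0_norm; last by rewrite exprn_ge0// invr_ge0.
exact: ltW.
Qed.

End Fourier.

(** * The density of the squared norm on a shell and its behaviour under dilation *)

Definition normsq (R : realType) (z : R * R) : R := z.1 ^+ 2 + z.2 ^+ 2.

Section shell_density.
Context (R : realType) (j : V3 R -> R) (vin vout : V3 R).
Implicit Types (A B : M3 R -> R) (k : V3 R) (t : R).

Let W k := velocity_gap vin vout (khat k).

(** The real part of $|k|^{3/2}(T_rF)(k)$ on the shell, and below it the imaginary part; the first
    summands come from $i\,\tilde j_0(k)W$, the others from the projections. *)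
Definition profile_re A B t k : R := - (FT j k).2 * W k +
  (A (khat k) * cos (enorm k * t) + B (khat k) * sin (enorm k * t)).

Definition profile_im A B t k : R := (FT j k).1 * W k +
  (- A (khat k) * sin (enorm k * t) + B (khat k) * cos (enorm k * t)).

Definition shell_density A B t k : R := (enorm k `^ (- (3 / 2))) ^+ 2 *
  (profile_re A B t k ^+ 2 + profile_im A B t k ^+ 2).

Lemma shell_density_ge0 A B t k : 0 <= shell_density A B t k.
Proof. by rewrite mulr_ge0 ?sqr_ge0// addr_ge0 ?sqr_ge0. Qed.

(** The bound on [sigma] makes both infrared cutoffs inactive on the whole shell. *)
Lemma Top_shell_density (r sigma : R) n : (0 < n)%N -> sigma <= eps R n.+1 ->
  exists A B, [/\ measurable_fun setT A, measurable_fun setT B &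
  forall k, eps R n.+1 < enorm k -> enorm k < eps R n ->
    normsq (Top r (csub (gcut j vout sigma) (gcut j vin sigma)) k) =
    shell_density A B (tau r n) k].
Proof.
move=> n0 sn.
have [A [B [mA mB TE]]] := Top_shell r (csub (gcut j vout sigma) (gcut j vin sigma)) n0.
exists A, B; split => // k h1 h2; rewrite (TE k h1 h2) /normsq/=.
rewrite /gcut (le_trans sn (ltW h1)).
rewrite /gfun /= /shell_density /profile_re /profile_im /W /velocity_gap /FT/=.
by move: (1 - _)^-1 (1 - _)^-1 => x y; ring.
Qed.

Lemma measurable_shell_density A B t :
  measurable_fun (setT : set (M3 R)) (fun k => (FT j k).1) ->
  measurable_fun (setT : set (M3 R)) (fun k => (FT j k).2) ->
  measurable_fun setT A -> measurable_fun setT B ->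
  measurable_fun (setT : set (M3 R)) (shell_density A B t).
Proof.
move=> m1 m2 mA mB.
have mn := @measurable_enorm R.
have mAk := measurableT_comp mA (@measurable_khat R).
have mBk := measurableT_comp mB (@measurable_khat R).
have mW : measurable_fun (setT : set (M3 R)) W.
  have h v : measurable_fun (setT : set (M3 R)) (fun u => (1 - dot u v)^-1).
    apply: (measurableT_comp (@measurable_invr R)).
    apply: measurable_funB; first exact: measurable_cst.
    have -> : (fun x : V3 R => dot x v) = dot v.
      by apply/funext => x; rewrite /dot; ring.
    exact: measurable_dot.
  by apply: (measurableT_comp _ (@measurable_khat R)); apply: measurable_funB.
have mnt : measurable_fun (setT : set (M3 R)) (fun k => enorm k * t).
  by apply: measurable_funM => //; exact: measurable_cst.
have mc : measurable_fun (setT : set (M3 R)) (fun k => cos (enorm k * t)).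
  apply: (measurableT_comp _ mnt); apply: continuous_measurable_fun.
  exact: continuous_cos.
have ms : measurable_fun (setT : set (M3 R)) (fun k => sin (enorm k * t)).
  apply: (measurableT_comp _ mnt); apply: continuous_measurable_fun.
  exact: continuous_sin.
apply: measurable_funM.
  by apply: measurable_funX; exact: (measurableT_comp (measurable_powR _) mn).
have re : measurable_fun (setT : set (M3 R)) (profile_re A B t).
  apply: measurable_funD.
    by apply: measurable_funM => //; exact: measurable_funN.
  by apply: measurable_funD; exact: measurable_funM.
have im : measurable_fun (setT : set (M3 R)) (profile_im A B t).
  apply: measurable_funD; first exact: measurable_funM.
  apply: measurable_funD; last exact: measurable_funM.
  by apply: measurable_funM => //; exact: measurable_funN.
by apply: measurable_funD; exact: measurable_funX.
Qed.

(* The dilation factor makes the phases at [k] and [lam k] differ by [|k| / (2 e)]. *)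
Lemma shell_density_dilation A B (r e L : R) k
    (d := vsub vout vin) (Q := (FT j (0, 0, 0)).1) (t := e `^ (r - 1))
    (lam := 1 + (2 * e `^ r)^-1) :
  enorm vin < 1 -> enorm vout < 1 ->
  (FT j (0, 0, 0)).2 = 0 ->
  0 <= L ->
  (forall k k', `|(FT j k).1 - (FT j k').1| <= L * dist1 k k' /\
     `|(FT j k).2 - (FT j k').2| <= L * dist1 k k') ->
  0 < e -> 1 <= e `^ r ->
  576 * (L * e) ^+ 2 <= Q ^+ 2 * (1 - cos (1 / 4)) ->
  e / 2 < enorm k -> enorm k < 2 / 3 * e ->
  enorm d / 2 <= `|dot (khat k) d| ->
  enorm d ^+ 2 * (Q ^+ 2 * (1 - cos (1 / 4))) / 256 * (e ^+ 3)^-1 <=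
  shell_density A B t k + lam ^+ 3 * shell_density A B t (vscale lam k).
Proof.
move=> vin1 vout1 F20 L0 FL e0 er1 eL k1 k2 kd.
have er0 : 0 < e `^ r by lra.
have k0 : 0 < enorm k by lra.
(* Hence [lam] is at most [3/2], and the dilate of a point with $|k|<2e/3$ still has norm at most
   [e]. *)
have x1 : (2 * e `^ r)^-1 <= 1 / 2.
  by rewrite div1r lef_pV2 ?posrE//; lra.
have x0 : 0 < (2 * e `^ r)^-1 by rewrite invr_gt0; lra.
have lam0 : 0 < lam by rewrite /lam; lra.
have lamk : enorm (vscale lam k) <= e.
  rewrite (enorm_vscale _ (ltW lam0)).
  apply: (@le_trans _ _ (3 / 2 * (2 / 3 * e))); last by lra.
  by apply: ler_pM; rewrite /lam; lra.
have small k' : enorm k' <= e ->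
    `|(FT j k').1 - Q| <= 3 * L * e /\ `|(FT j k').2| <= 3 * L * e.
  move=> k'e; have [f1 f2] := FL k' (0, 0, 0).
  have [h1 h2 h3] := abs_c_le_enorm k'.
  have dk : L * dist1 k' (0, 0, 0) <= 3 * L * e.
    rewrite (_ : 3 * L * e = L * (3 * e)); last by ring.
    by apply: ler_wpM2l => //; rewrite /dist1 /c1 /c2 /c3/= !subr0; move: h1 h2 h3;
      rewrite /c1 /c2 /c3; lra.
  rewrite F20 subr0 in f2.
  by split; [exact: le_trans f1 dk|exact: le_trans f2 dk].
have [f1 f2] : `|(FT j k).1 - Q| <= 3 * L * e /\ `|(FT j k).2| <= 3 * L * e.
  by apply: small; lra.
have [g1 g2] := small _ lamk.
have := @phase_gap R (W k) Q (3 * L * e) (A (khat k)) (B (khat k)) _ _ _ _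
  (enorm k * t) (lam * enorm k * t) f1 f2 g1 g2.
rewrite -/(profile_re A B t k) -/(profile_im A B t k).
have khl := khat_vscale k lam0.
have enl := enorm_vscale k (ltW lam0).
rewrite (_ : - (FT j (vscale lam k)).2 * W k + _ = profile_re A B t (vscale lam k));
  last by rewrite /profile_re /W khl enl.
rewrite (_ : (FT j (vscale lam k)).1 * W k + _ = profile_im A B t (vscale lam k));
  last by rewrite /profile_im /W khl enl.
set S1 := profile_re _ _ _ k ^+ 2 + _; set S2 := profile_re _ _ _ (vscale lam k) ^+ 2 + _.
have -> : lam * enorm k * t - enorm k * t = enorm k / (2 * e).
  rewrite /t powRB; last by rewrite (gt_eqF e0) implybT.
  rewrite powRr1 ?ltW// /lam; field.
  by rewrite !gt_eqF.
have cg : 1 - cos (1 / 4) <= 1 - cos (enorm k / (2 * e)).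
  have e20 : 0 < 2 * e by lra.
  by apply: cos_gap; [rewrite ler_pdivlMr//|rewrite ler_pdivrMr//]; lra.
have kap : 0 < 1 - cos (1 / 4) :> R by exact: cos_quarter_lt1.
(* From $|W|\ge|\hat k\cdot d|/4\ge|d|/8$. *)
have WN : enorm d ^+ 2 / 64 <= W k ^+ 2.
  have := velocity_gap_lower vin1 vout1 (dot_khat_khat k0).
  rewrite -/(W k) -/d => h.
  have h8 : enorm d / 8 <= `|W k| by lra.
  rewrite -(@real_normK _ (W k)) ?num_real//.
  rewrite (_ : _ / 64 = (enorm d / 8) ^+ 2); last by field.
  by rewrite ler_pXn2r ?nnegrE// divr_ge0// enorm_ge0.
move=> H.
set m := Q ^+ 2 * (1 - cos (1 / 4)) in eL *.
have m0 : 0 <= m by rewrite mulr_ge0 ?sqr_ge0// ltW.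
have HS : enorm d ^+ 2 * m / 256 <= S1 + S2.
  apply: le_trans H.
  (* With [eta = 3 * L * e] the error $32\,\eta^2=288(Le)^2$ is at most [m / 2], by the choice of
     [576]. The factors [1/64], [1/2] and the halving in [phase_gap] make [1/256]. *)
  have hm : m / 2 <= Q ^+ 2 * (1 - cos (enorm k / (2 * e))) - 32 * (3 * L * e) ^+ 2.
    have : m <= Q ^+ 2 * (1 - cos (enorm k / (2 * e))) by rewrite ler_wpM2l ?sqr_ge0.
    have -> : 32 * (3 * L * e) ^+ 2 = 576 * (L * e) ^+ 2 / 2 by field.
    lra.
  have : enorm d ^+ 2 / 64 * (m / 2) <= W k ^+ 2 *
     (Q ^+ 2 * (1 - cos (enorm k / (2 * e))) - 32 * (3 * L * e) ^+ 2).
    by apply: ler_pM => //; rewrite divr_ge0 ?sqr_ge0.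
  lra.
rewrite /shell_density -/S1 -/S2 enl powRM ?(ltW lam0) ?(ltW k0)// exprMn.
rewrite (powR_N32_sqr lam0) (powR_N32_sqr k0).
(* The Jacobian $\lambda^3$ cancels $|\lambda k|^{-3}$ up to $|k|^{-3}$. *)
have cancel (x y z : R) : x != 0 -> x * (x^-1 * y * z) = y * z.
  by move=> ?; field.
rewrite cancel; last by rewrite gt_eqF// exprn_gt0.
rewrite -mulrDr [leLHS]mulrC; apply: ler_pM => //.
- by rewrite invr_ge0 exprn_ge0// ltW.
- by rewrite divr_ge0// mulr_ge0 ?sqr_ge0.
rewrite lef_pV2 ?posrE ?exprn_gt0// ler_pXn2r ?nnegrE ?ltW//; lra.
Qed.

End shell_density.

(** * Integration over a set and its dilate *)

Section dilated_set.
Context (R : realType) (P : M3 R -> R) (C : set (M3 R)) (lam : R).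
Hypotheses (mP : measurable_fun setT P) (P0 : forall k, 0 <= P k).
Hypotheses (mC : measurable C) (lam0 : 0 < lam).

(** [C] and its dilate by [lam] may overlap; the factor [1/2] keeps the density below [P] there. *)
Definition two_set_density (k : M3 R) : R :=
  2^-1 * ((\1_C k + \1_C (vscale lam^-1 k : M3 R)) * P k).

Let indic_ge0 k : 0 <= \1_C k :> R. Proof. by rewrite indicE. Qed.

Let mC1 : measurable_fun setT (\1_C : M3 R -> R). Proof. exact: measurable_indic. Qed.

Let mC2 : measurable_fun setT (fun k : M3 R => \1_C (vscale lam^-1 k : M3 R) : R).
Proof. exact: (measurableT_comp mC1 (measurable_vscale _)). Qed.

Lemma measurable_two_set_density : measurable_fun setT two_set_density.
Proof.
apply: measurable_funM; first exact: measurable_cst.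
by apply: measurable_funM => //; exact: measurable_funD.
Qed.

Lemma two_set_density_ge0 k : 0 <= two_set_density k.
Proof. by rewrite /two_set_density mulr_ge0 ?invr_ge0// mulr_ge0// addr_ge0. Qed.

Lemma two_set_density_le k : two_set_density k <= P k.
Proof.
rewrite /two_set_density mulrA ler_piMl// !indicE.
by case: (_ \in _); case: (_ \in _) => /=; rewrite ler_pdivrMl//; lra.
Qed.

Lemma two_set_density_supp k : two_set_density k != 0 -> C k \/ C (vscale lam^-1 k).
Proof.
rewrite /two_set_density !indicE.
case: (boolP (k \in C)) => [/set_mem|_]; first by left.
case: (boolP (_ \in C)) => [/set_mem|_]; first by right.
by rewrite /= addr0 mul0r mulr0 eqxx.
Qed.

Lemma integral_two_set_density (c : R) : 0 <= c ->
  (forall k, C k -> c <= P k + lam ^+ 3 * P (vscale lam k)) ->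
  ((c / 2)%:E * @leb3 R C <= \int[@leb3 R]_k (two_set_density k)%:E)%E.
Proof.
move=> c0 Pc.
have l3 : 0 <= lam ^+ 3 by rewrite exprn_ge0// ltW.
have mPl : measurable_fun setT (fun k : M3 R => P (vscale lam k)).
  exact: (measurableT_comp mP (measurable_vscale _)).
have vK k : vscale lam^-1 (vscale lam k) = k.
  case: k => -[x y] z; rewrite /vscale /c1 /c2 /c3/=.
  by rewrite !mulrA mulVf ?gt_eqF// !mul1r.
(* The substitution of [lam k] for [k] moves the integral over the dilate of [C] back to [C], so
   that [P] can be compared at two points of one ray. *)
have I2 : (\int[@leb3 R]_k (\1_C (vscale lam^-1 k : M3 R) * P k)%:E =
    \int[@leb3 R]_k (\1_C k * (lam ^+ 3 * P (vscale lam k)))%:E)%E.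
  rewrite (leb3_integral_scale lam0); last 2 first.
  - by apply/measurable_EFinP; exact: measurable_funM.
  - by move=> k; rewrite lee_fin mulr_ge0.
  rewrite -ge0_integralZl//; last 2 first.
  - apply/measurable_EFinP.
    exact: (measurableT_comp (measurable_funM mC2 mP) (measurable_vscale lam)).
  - by move=> k _; rewrite lee_fin mulr_ge0.
  - apply: eq_integral => k _; rewrite -EFinM; congr EFin.
    by rewrite vK; ring.
have -> : (\int[@leb3 R]_k (two_set_density k)%:E = (2^-1)%:E *
   \int[@leb3 R]_k (\1_C k * (P k + lam ^+ 3 * P (vscale lam k)))%:E)%E.
  rewrite /two_set_density.
  under eq_integral do rewrite EFinM mulrDl EFinD.
  rewrite ge0_integralZl//; last 2 first.
  - apply: emeasurable_funD; apply/measurable_EFinP; exact: measurable_funM.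
  - by move=> k _; rewrite -EFinD lee_fin addr_ge0// mulr_ge0.
  have n1 (k : M3 R) : setT k -> (0 <= (\1_C k * P k)%:E)%E.
    by move=> _; rewrite lee_fin; apply: mulr_ge0; [exact: indic_ge0|exact: P0].
  have n2 (k : M3 R) : setT k -> (0 <= (\1_C (vscale lam^-1 k : M3 R) * P k)%:E)%E.
    by move=> _; rewrite lee_fin; apply: mulr_ge0; [exact: indic_ge0|exact: P0].
  have n3 (k : M3 R) : setT k -> (0 <= (\1_C k * (lam ^+ 3 * P (vscale lam k)))%:E)%E.
    move=> _; rewrite lee_fin; apply: mulr_ge0; first exact: indic_ge0.
    by apply: mulr_ge0.
  have m1 : measurable_fun setT (fun k : M3 R => (\1_C k * P k)%:E).
    by apply/measurable_EFinP; exact: measurable_funM.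
  have m2 : measurable_fun setT (fun k : M3 R => (\1_C (vscale lam^-1 k : M3 R) * P k)%:E).
    by apply/measurable_EFinP; exact: measurable_funM.
  have m3 : measurable_fun setT (fun k : M3 R => (\1_C k * (lam ^+ 3 * P (vscale lam k)))%:E).
    apply/measurable_EFinP; apply: measurable_funM => //.
    by apply: measurable_funM => //; exact: measurable_cst.
  congr (_ * _)%E; rewrite (ge0_integralD _ _ n1 m1 n2 m2)// I2.
  rewrite -(ge0_integralD _ _ n1 m1 n3 m3)//.
  by apply: eq_integral => k _; rewrite -EFinD -mulrDr.
rewrite mulrC EFinM -muleA; apply: lee_wpmul2l; first by rewrite lee_fin invr_ge0.
have -> : (c%:E * @leb3 R C = \int[@leb3 R]_k (c * \1_C k)%:E)%E.
  under eq_integral do rewrite EFinM.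
  rewrite ge0_integralZl//; last exact/measurable_EFinP.
  by rewrite integral_indic// setIT.
apply: ge0_le_integralT => k; first by rewrite lee_fin mulr_ge0.
rewrite lee_fin mulrC indicE; case: (boolP (k \in C)) => [/set_mem/Pc h|_] /=.
  by rewrite !mul1r.
by rewrite !mul0r.
Qed.

End dilated_set.

(** * The uniform contribution of each shell and the divergence *)

(** The constant [c] is independent of [n] and [sigma]. [G] is a measurable minorant supported in
    one open shell, so the minorants of different shells can be added. *)
Lemma shell_bound (R : realType) (r : R) (j0 : V3 R -> R) (vin vout : V3 R) :
  r <= 0 -> test_function j0 -> Rintegral (@leb3 R) setT j0 != 0 ->
  enorm vin < 1 -> enorm vout < 1 -> vin != vout ->
  exists2 c : R, 0 < c & exists2 n0, (0 < n0)%N &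
  forall n sigma, (n0 <= n)%N -> sigma <= eps R n.+1 ->
  exists G : M3 R -> R, [/\ measurable_fun setT G, forall k, 0 <= G k,
    forall k, G k != 0 -> eps R n.+1 < enorm k /\ enorm k < eps R n,
    forall k, G k <= normsq (Top r (csub (gcut j0 vout sigma) (gcut j0 vin sigma)) k) &
    (c%:E <= \int[@leb3 R]_k (G k)%:E)%E].
Proof.
move=> r0 tj q0 vin1 vout1 vv.
have [L L0 FL] := FT_lipschitz tj q0.
have mF1 : measurable_fun (setT : set (M3 R)) (fun k => (FT j0 k).1).
  apply: continuous_measurable_R3; apply: (dist1_lipschitz_continuous L0).
  by move=> k k'; have [] := FL k k'.
have mF2 : measurable_fun (setT : set (M3 R)) (fun k => (FT j0 k).2).
  apply: continuous_measurable_R3; apply: (dist1_lipschitz_continuous L0).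
  by move=> k k'; have [] := FL k k'.
have F20 : (FT j0 (0, 0, 0)).2 = 0 by rewrite FT_at0.
pose Q := (FT j0 (0, 0, 0)).1.
have Q0 : Q != 0.
  rewrite /Q FT_at0/= mulf_neq0// gt_eqF// powR_gt0// mulr_gt0// .
  exact: pi_gt0.
pose m := Q ^+ 2 * (1 - cos (1 / 4)).
have m0 : 0 < m by rewrite mulr_gt0 ?cos_quarter_lt1// exprn_even_gt0.
pose d := vsub vout vin.
have d0 : 0 < enorm d.
  rewrite lt_neqAle enorm_ge0 andbT eq_sym; apply: contra vv => /eqP dz.
  have : dot d d = 0 by rewrite -enorm_sqr dz expr0n.
  rewrite /dot -!expr2 => ddz.
  have s1 := sqr_ge0 (c1 d); have s2 := sqr_ge0 (c2 d); have s3 := sqr_ge0 (c3 d).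
  have sq0 (x : R) : x ^+ 2 = 0 -> x = 0 by move/eqP; rewrite sqrf_eq0 => /eqP.
  have e1 : c1 d = 0 by apply: sq0; lra.
  have e2 : c2 d = 0 by apply: sq0; lra.
  have e3 : c3 d = 0 by apply: sq0; lra.
  move: e1 e2 e3; rewrite /d /vsub /c1 /c2 /c3/=.
  case: (vin) (vout) => -[x y] z [[x' y'] z'] /= e1 e2 e3.
  by apply/eqP; congr (_, _, _); lra.
pose c := enorm d ^+ 2 * m / 256.
have c0 : 0 < c by rewrite divr_gt0// mulr_gt0// exprn_gt0.
(* With [e <= 1] and [e <= m / D] one gets $576(Le)^2\le 576L^2e\le De\le m$. *)
pose D := 576 * L ^+ 2 + 1.
have D0 : 1 <= D by rewrite /D; have := sqr_ge0 L; lra.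
have [n0 n00 epsn] : exists2 n0, (0 < n0)%N &
    forall n, (n0 <= n)%N -> eps R n <= Num.min 1 (m / D).
  by apply: eps_to0; rewrite lt_min ltr01 divr_gt0//; lra.
(* [c / 2] comes from averaging over two sets, and $(1/50)^3$ is the volume of the cube divided by
   $e^3$. *)
exists (c / 2 * (1 / 50) ^+ 3); first by rewrite mulr_gt0// ?exprn_gt0// divr_gt0.
exists n0 => // n sigma nn sn.
have n1 : (0 < n)%N by exact: leq_trans nn.
have [A [B [mA mB TE]]] := Top_shell_density j0 vin vout r n1 sn.
pose e := eps R n.
have e0 : 0 < e by exact: eps_gt0.
have := epsn n nn; rewrite le_min -/e => /andP[e1 em].
(* Here [r <= 0] enters, together with [e <= 1]. *)
have er1 : 1 <= e `^ r.
  by rewrite -(powRr0 e); apply: ger_powR; rewrite ?e0.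
have eL : 576 * (L * e) ^+ 2 <= m.
  move: em; rewrite ler_pdivlMr; last by lra.
  apply: le_trans; rewrite /D.
  have := sqr_ge0 L; have -> : 576 * (L * e) ^+ 2 = (576 * L ^+ 2) * e * e by ring.
  move=> h; have : 576 * L ^+ 2 * e * e <= 576 * L ^+ 2 * e.
    apply: ler_piMr e1; apply: mulr_ge0 (ltW e0).
    by apply: mulr_ge0 (sqr_ge0 L); exact: ler0n.
  lra.
have en : eps R n.+1 = e / 2.
  by rewrite /e /eps; case: (n) n1 => // p _ /=; rewrite exprSr.
pose k0 := vscale (7 / (12 * enorm d)) d.
pose C := cube k0 e (1 / 100).
pose lam := 1 + (2 * e `^ r)^-1.
have x0 : 0 < (2 * e `^ r)^-1 by rewrite invr_gt0; lra.
have x1 : (2 * e `^ r)^-1 <= 1 / 2.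
  by rewrite div1r lef_pV2 ?posrE//; lra.
have lam0 : 0 < lam by rewrite /lam; lra.
pose P := shell_density j0 vin vout A B (tau r n).
have mP : measurable_fun (setT : set (M3 R)) P by exact: measurable_shell_density.
have P0 k : 0 <= P k by exact: shell_density_ge0.
have mC : measurable C by exact: measurable_cube.
(* Since $1<\lambda\le3/2$, the cube in $e/2<|k|<2e/3$ and its dilate both stay in the open
   shell. *)
have supp k : two_set_density P C lam k != 0 -> eps R n.+1 < enorm k /\ enorm k < eps R n.
  rewrite en -/e => /two_set_density_supp[|] /(cube_geometry d0 e0)[h1 h2 _].
    by split; lra.
  move: h1 h2; rewrite enorm_vscale; last by rewrite invr_ge0 ltW.
  rewrite ltr_pdivlMl// ltr_pdivrMl// => h1 h2; split.
    by apply: le_lt_trans h1; rewrite ler_peMl ?divr_ge0 ?(ltW e0)// /lam; lra.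
  apply: lt_le_trans h2 _.
  have : lam * (2 / 3 * e) <= 3 / 2 * (2 / 3 * e).
    by apply: ler_wpM2r; rewrite ?/lam; lra.
  lra.
exists (two_set_density P C lam); split => //.
- exact: measurable_two_set_density.
- by move=> k; exact: two_set_density_ge0.
- move=> k; have [->|/supp[h1 h2]] := eqVneq (two_set_density P C lam k) 0.
    by rewrite addr_ge0 ?sqr_ge0.
  by rewrite (TE k h1 h2); exact: two_set_density_le.
apply: le_trans (integral_two_set_density mP P0 mC lam0 (_ : 0 <= c * (e ^+ 3)^-1) _).
- rewrite leb3_cube// -EFinM lee_fin.
  rewrite (_ : (2 * e * (1 / 100)) ^+ 3 = e ^+ 3 * (1 / 50) ^+ 3); last by field.
  have cancel (x y z : R) : z != 0 -> x / 2 * y = (x * z^-1) / 2 * (z * y).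
    by move=> ?; field.
  by rewrite (cancel c _ (e ^+ 3))// gt_eqF// exprn_gt0.
- by rewrite mulr_ge0 ?(ltW c0)// invr_ge0 exprn_ge0// ltW.
- move=> k /(cube_geometry d0 e0)[h1 h2 h3].
  exact: (shell_density_dilation A B vin1 vout1 F20 L0 FL e0 er1 eL h1 h2 h3).
Qed.

Lemma L2norm_ge (R : realType) (F : cfun R) (a : R) : 0 <= a ->
  (((a ^+ 2)%:E <= \int[@leb3 R]_k (normsq (F k))%:E)%E -> (a%:E <= L2norm F)%E).
Proof.
move=> a0 h; rewrite /L2norm unlock /=.
have -> : (\int[@leb3 R]_k (`|(Num.sqrt ((F k).1 ^+ 2 + (F k).2 ^+ 2))%:E| `^ 2)%E =
    \int[@leb3 R]_k (normsq (F k))%:E)%E.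
  apply: eq_integral => k _; rewrite gee0_abs ?lee_fin ?sqrtr_ge0// poweR_EFin; congr EFin.
  rewrite powR_mulrn ?sqrtr_ge0//.
  by rewrite sqr_sqrtr// addr_ge0 ?sqr_ge0.
have -> : a%:E = ((a ^+ 2)%:E `^ 2^-1)%E.
  by rewrite poweR_EFin powR12_sqrt ?sqr_ge0// sqrtr_sqr ger0_norm.
by apply: gt0_ler_poweR => //; rewrite ?in_itv/= ?leey ?andbT ?lee_fin ?sqr_ge0//;
  apply: integral_ge0 => k _; rewrite lee_fin addr_ge0 ?sqr_ge0.
Qed.

Theorem theorem4p1 (R : realType) (r : R) (j0 : V3 R -> R) (vin vout : V3 R) :
  r <= 0 ->
  test_function j0 ->
  spherically_symmetric j0 ->
  Rintegral (@leb3 R) setT j0 != 0 ->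
  enorm vin < 1 -> enorm vout < 1 -> vin != vout ->
  (L2norm (Top r (csub (gcut j0 vout sigma) (gcut j0 vin sigma))) : \bar R)
     @[sigma --> 0^'+] --> +oo%E.
Proof.
move=> r0 tj _ q0 vin1 vout1 vv.
have [c c0 [n0 n00 HG]] := shell_bound r0 tj q0 vin1 vout1 vv.
apply/cvgeyPge => A.
(* [m] is the number of shells that suffices for a norm of at least [|A|]. *)
have [m mA] : exists m : nat, A ^+ 2 <= m%:R * c.
  exists (Num.bound (A ^+ 2 / c)); rewrite -ler_pdivrMr//.
  by apply: ltW; apply: archi_boundP; rewrite divr_ge0 ?sqr_ge0// ltW.
(* For [sigma] below this radius the cutoff leaves the shells [n0], ..., [n0 + m - 1] untouched. *)
have e0 : 0 < eps R (n0 + m).+1 by exact: eps_gt0.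
near=> sigma.
have se : sigma <= eps R (n0 + m).+1 by near: sigma; exact: nbhs_right_le.
set F := Top _ _.
have HG' (i : 'I_m) : exists G : M3 R -> R, [/\ measurable_fun setT G, forall k, 0 <= G k,
    forall k, G k != 0 -> eps R (n0 + i).+1 < enorm k /\ enorm k < eps R (n0 + i),
    forall k, G k <= normsq (F k) & (c%:E <= \int[@leb3 R]_k (G k)%:E)%E].
  apply: HG; first exact: leq_addr.
  by apply: le_trans se _; apply: eps_le; rewrite ltnS leq_add2l ltnW.
have /choice[G hG] := HG'.
apply: (@le_trans _ _ `|A|%:E); first by rewrite lee_fin ler_norm.
apply: L2norm_ge => //; rewrite real_normK ?num_real//.
apply: (@le_trans _ _ (\int[@leb3 R]_k (\sum_(i < m) (G i k)%:E))%E); last first.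
  apply: ge0_le_integralT => k.
    by apply: sume_ge0 => i _; rewrite lee_fin; case: (hG i).
  rewrite sumEFin lee_fin.
  (* The open shells are disjoint, so at each [k] at most one [G i] is nonzero and the sum is still
     dominated by [normsq (F k)]. *)
  have [/forallP G0|/forallPn[i Gi]] := boolP [forall i, G i k == 0].
    by rewrite big1 ?addr_ge0 ?sqr_ge0// => i _; exact/eqP.
  have [_ _ /(_ k Gi)[k1 k2] /(_ k) Gle _] := hG i.
  rewrite (bigD1 i)//= big1 ?addr0// => l li; apply/eqP/negP => /negP Gl.
  have [_ _ /(_ k Gl)[k3 k4] _ _] := hG l.
  move: li; rewrite -val_eqE/= neq_ltn => /orP[h|h].
    have : eps R (n0 + i) <= eps R (n0 + l).+1 by rewrite eps_le// ltn_add2l.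
    by rewrite leNgt (lt_trans k3 k2).
  have : eps R (n0 + l) <= eps R (n0 + i).+1 by rewrite eps_le// ltn_add2l.
  by rewrite leNgt (lt_trans k1 k4).
rewrite ge0_integral_sum//; last 2 first.
- by move=> i; apply/measurable_EFinP; case: (hG i).
- by move=> i k _; rewrite lee_fin; case: (hG i).
apply: (@le_trans _ _ (\sum_(i < m) c%:E)%E); last first.
  by apply: lee_sum => i _; case: (hG i).
by rewrite sumEFin lee_fin sumr_const card_ord -mulr_natl.
Unshelve. all: by end_near. Qed.
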